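(* There exists a locally nilpotent ring $R$ and a derivation $D$ of $R$ such that the differential polynomial ring $R[X;D]$ is not Jacobson radical, i.e. $J(R[X;D])\neq R[X;D]$.
   Context: A ring is locally nilpotent if every finitely generated subring is nilpotent. For a derivation $D$ of $R$, $R[X;D]$ is the ring of polynomials $\sum a_iX^i$, $a_i\in R$, with pointwise addition and multiplication determined by $X^iX^j=X^{i+j}$ and $Xa=aX+D(a)$. $J(\cdot)$ denotes the Jacobson radical; a ring $S$ is Jacobson radical if $J(S)=S$. *)

(* Defs.v *)
From HB Require Import structures.
From mathcomp Require Import all_boot all_order all_algebra.
Set Implicit Arguments. Unset Strict Implicit. Unset Printing Implicit Defensive.
Import GRing.Theory.
Local Open Scope ring_scope.

Record nuRing := NURing {
  nu_car :> zmodType;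
  nu_mul : nu_car -> nu_car -> nu_car;
  nu_mulA : associative nu_mul;
  nu_mulDl : left_distributive nu_mul +%R;
  nu_mulDr : right_distributive nu_mul +%R }.

Section NURingDefs.
Variable R : nuRing.
Local Notation mul := (@nu_mul R).

Inductive gen_subring (s : seq R) : R -> Prop :=
  | gs_mem x : x \in s -> gen_subring s x
  | gs_0 : gen_subring s 0
  | gs_add x y : gen_subring s x -> gen_subring s y -> gen_subring s (x + y)
  | gs_opp x : gen_subring s x -> gen_subring s (- x)
  | gs_mul x y : gen_subring s x -> gen_subring s y -> gen_subring s (mul x y).

(* A subring A (given as a predicate) is nilpotent: A^(n+1) = 0 for some n,
   i.e. every product x * y_1 * ... * y_n of n+1 elements of A vanishes. *)
Definition nilpotent_subring (A : R -> Prop) : Prop :=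
  exists n : nat, forall (x : R) (ys : seq R),
    size ys = n -> A x -> (forall y, y \in ys -> A y) -> foldl mul x ys = 0.

Definition locally_nilpotent : Prop :=
  forall s : seq R, nilpotent_subring (gen_subring s).

Definition derivation (D : R -> R) : Prop :=
  (forall x y, D (x + y) = D x + D y) /\
  (forall x y, D (mul x y) = mul (D x) y + mul x (D y)).

(* Elements are coefficient lists [a_0; a_1; ...] (a_i the coefficient of X^i)
   in normal form, i.e. without trailing zeros. *)
Definition trim (s : seq R) : seq R :=
  foldr (fun x acc => if (acc == [::]) && (x == 0) then [::] else x :: acc)
        [::] s.

Definition is_dpoly (p : seq R) : Prop := trim p = p.

Definition dcoef (p : seq R) (i : nat) : R := nth 0 p i.

Definition dadd (p q : seq R) : seq R :=
  trim (mkseq (fun i => dcoef p i + dcoef q i) (maxn (size p) (size q))).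

Definition dopp (p : seq R) : seq R := trim (map (fun x => - x) p).

(* Multiplication determined by X^i X^j = X^(i+j) and X a = a X + D(a), i.e.
   (a X^i)(b X^j) = sum_(k <= i) C(i,k) a D^k(b) X^(i+j-k). *)
Definition dmul (D : R -> R) (p q : seq R) : seq R :=
  trim (mkseq (fun n =>
     \sum_(i < size p) \sum_(j < size q) \sum_(k < i.+1 | (i + j == n + k)%N)
        (mul (dcoef p i) (iter k D (dcoef q j))) *+ 'C(i, k))
     (size p + size q)).

Definition right_quasi_regular (D : R -> R) (p : seq R) : Prop :=
  exists q, is_dpoly q /\ dadd p (dadd q (dopp (dmul D p q))) = [::].

Definition right_ideal (D : R -> R) (I : seq R -> Prop) : Prop :=
  [/\ forall p, I p -> is_dpoly p,
      I [::],
      forall p q, I p -> I q -> I (dadd p q),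
      forall p, I p -> I (dopp p) &
      forall p r, I p -> is_dpoly r -> I (dmul D p r)].

(* Jacobson radical of R[X;D] (for rings possibly without identity): the sum
   (= union, being the largest one) of all right quasi-regular right ideals. *)
Definition jacobson_radical (D : R -> R) (p : seq R) : Prop :=
  exists I, [/\ right_ideal D I, forall q, I q -> right_quasi_regular D q & I p].

Definition dpoly_jacobson_radical (D : R -> R) : Prop :=
  forall p, is_dpoly p -> jacobson_radical D p.

End NURingDefs.

(* Main.v *)
(**
Sending [X] to an operator [t] turns [R[X;D]], for [D T = t T - T t], into a
ring of operators. Positions on the half-line are cut, for every level [l],
into consecutive blocks of length [4^(l+1)], the blocks of level [l] refining
those of level [l+1], and a state carries a position and one exponent per level.
The operator [t = raise_op] raises one exponent by one, summed over the levels;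
[a = step_op] moves
one position to the right, and when this leaves a block of level [l] it requires
the [l]-th exponent to equal a quota larger than [2l] and resets it to [0].
Commutators with [t] only see the levels whose block is left, so an operator
obtained from [a] by at most [m] commutators can enter a block of level [m] only
with exponent at most [m] and leave it only within [m] of the quota. Products of
such operators thus never traverse a whole block of level [m]: they form a
nilpotent ring, and the union [R] over [m] is locally nilpotent. A quasi-inverse
of [aX], evaluated at [t], would be minus the sum of all powers of [a t]; but
[a t] walks arbitrarily far, raising at position [j] the level given by the
2-adic valuation of [j+1], whereas elements of [R] traverse no large block.
*)

Require Import Defs.
From HB Require Import structures.
From mathcomp Require Import all_boot all_order all_algebra.
From mathcomp Require Import boolp functions zify.
Set Implicit Arguments. Unset Strict Implicit. Unset Printing Implicit Defensive.
Import Order.TTheory GRing.Theory Num.Theory.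
Local Open Scope ring_scope.

(** * Nested blocks of positions *)

Definition blen (l : nat) : nat := (4 ^ l.+1)%N.
Definition cell (l j : nat) : nat := (j %/ blen l)%N.
(* The level raised at position [j] along the walk. *)
Definition sched (j : nat) : nat := logn 2 j.+1.
Definition visits (l n : nat) : nat := (\sum_(i < n) (sched i == l))%N.
(** Number of raises of level [l] along one block of that level; by periodicity of [sched] it is the
    same for every block. *)
Definition quota (l : nat) : nat := visits l (blen l).

Lemma blen_gt0 l : (0 < blen l)%N.
Proof. by rewrite expn_gt0. Qed.

Lemma leq_cell l i j : (i <= j)%N -> (cell l i <= cell l j)%N.
Proof. exact: leq_div2r. Qed.

Lemma cellS l j : cell l.+1 j = (cell l j %/ 4)%N.
Proof. by rewrite /cell /blen expnSr divnMA. Qed.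

Lemma cell_far l i j : (i + 2 * blen l <= j)%N -> (cell l i + 2 <= cell l j)%N.
Proof.
by move=> h; rewrite /cell addnC -divnMDl ?blen_gt0 // leq_div2r // addnC.
Qed.

Lemma sched_eqE l j :
  (sched j == l) = (2 ^ l %| j.+1)%N && ~~ (2 ^ l.+1 %| j.+1)%N.
Proof. by rewrite !pfactor_dvdn // -leqNgt eqn_leq andbC. Qed.

(** Valuation [l] of [j.+1] is decided modulo [2 ^ l.+1], which divides [blen l]; so each block of
    level [l] repeats the same raises of that level. *)
Lemma sched_eq_mod l q i j : (2 ^ l.+1 %| q)%N -> i = j %[mod q] ->
  (sched i == l) = (sched j == l).
Proof.
move=> dq eij; rewrite !sched_eqE.
have E k : (2 ^ k %| q)%N -> (2 ^ k %| i.+1)%N = (2 ^ k %| j.+1)%N.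
  move=> dk; rewrite /dvdn; congr (_ == _).
  rewrite -(modn_dvdm i.+1 dk) -(modn_dvdm j.+1 dk).
  by rewrite -addn1 -modnDml eij modnDml addn1.
by rewrite !E // (dvdn_trans _ dq) // dvdn_exp2l.
Qed.

Lemma dvdn_blen l : (2 ^ l.+1 %| blen l)%N.
Proof. by rewrite /blen (expnMn 2 2) dvdn_mulr. Qed.

Lemma visits_mul l n : (n <= visits l (n * 2 ^ l.+1))%N.
Proof.
elim: n => // n IH.
rewrite mulSn addnC /visits big_split_ord /= -addn1 leq_add //.
(* In each period, the residue [2 ^ l - 1] makes [j.+1] congruent to [2 ^ l], of valuation exactly
   [l]. *)
have h : (2 ^ l - 1 < 2 ^ l.+1)%N.
  by rewrite expnS; have := expn_gt0 2 l; lia.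
rewrite (bigD1 (Ordinal h)) //=.
suff -> : (sched (n * 2 ^ l.+1 + (2 ^ l - 1)) == l) by [].
rewrite (@sched_eq_mod l (2 ^ l.+1) _ (2 ^ l - 1)) ?modnMDl //.
by rewrite /sched subn1 prednK ?expn_gt0 // pfactorK.
Qed.

(** A block holds [2 ^ l.+1] periods, each with a raise. The gap ensures that an exponent at most
    [l] on entry is not within [l] of the quota. *)
Lemma quota_gt l : (2 * l < quota l)%N.
Proof.
apply: leq_trans (_ : 2 ^ l.+1 <= _)%N.
  by rewrite expnS; have := ltn_expl l (isT : (1 < 2)%N); lia.
by rewrite /quota /blen (expnMn 2 2) visits_mul.
Qed.

(** * Operators *)

(* [lev] is inert: it bounds the levels that [raise_op] sums over, making the sum
   finite; no single bound would allow walks of every length. *)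
Record state := State { lev : nat; pos : nat; ex : nat -> nat }.
Local Notation vect := (state -> int).
Local Notation op := (vect -> vect).

Definition shift (l : nat) (x : state) : state :=
  State (lev x) (pos x) (fun i => ex x i + (i == l))%N.

Lemma shiftC l k x : shift l (shift k x) = shift k (shift l x).
Proof. by congr State; apply/funext => i /=; rewrite addnAC. Qed.

Definition subtractive (T : op) := forall g h, T (g - h) = T g - T h.

Section Subtractive.
Variable T : op.
Hypothesis T_sub : subtractive T.

Lemma subtractive0 : T 0 = 0.
Proof. by have := T_sub 0 0; rewrite !subrr. Qed.

Lemma subtractiveN g : T (- g) = - T g.
Proof. by rewrite -[- g]sub0r T_sub subtractive0 sub0r. Qed.

Lemma subtractiveD g h : T (g + h) = T g + T h.
Proof. by rewrite -{1}[h]opprK T_sub subtractiveN opprK. Qed.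

Lemma subtractive_sum n (g : nat -> vect) :
  T (\sum_(i < n) g i) = \sum_(i < n) T (g i).
Proof. by rewrite (big_morph T subtractiveD subtractive0). Qed.

End Subtractive.

Definition supported (r : state -> state -> Prop) (T : op) :=
  forall x g, (forall y, r x y -> g y = 0) -> T g x = 0.

Lemma supported_eq r T x g h : subtractive T -> supported r T ->
  (forall y, r x y -> g y = h y) -> T g x = T h x.
Proof.
move=> Tsub Ts e; apply/eqP; rewrite -subr_eq0; apply/eqP.
have -> : T g x - T h x = T (g - h) x by rewrite Tsub.
by apply: Ts => y /e /= ; rewrite !fctE => ->; rewrite subrr.
Qed.

(** * Transitions and bounded operators *)

Definition transition (m : nat) (x y : state) : Prop :=
  [/\ lev y = lev x, (pos x < pos y)%N,
      (cell m (pos y) <= (cell m (pos x)).+1)%N &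
      forall l, if cell l (pos x) == cell l (pos y) then ex y l = ex x l
                else (quota l <= ex x l + m)%N /\ (ex y l <= m)%N].

(** If both steps changed the block of level [m], the exponent of [z] at that level would be at most
    [m] and at least [quota m - m], against [quota_gt]. Hence composing does not increase [m]. *)
Lemma transition_trans m x z y : transition m x z -> transition m z y -> transition m x y.
Proof.
move=> [lxz pxz cxz exz] [lzy pzy czy ezy].
have cm l := (leq_cell l (ltnW pxz), leq_cell l (ltnW pzy)).
split; first by rewrite lzy.
- exact: ltn_trans pzy.
- case: leqP => // far.
  have := quota_gt m; have := exz m; have := ezy m.
  by case: eqP => [|_ []]; case: eqP => [|_ []]; move: (cm m) => []; lia.
- move=> l; have := exz l; have := ezy l; have [c1 c2] := cm l.
  case: (eqVneq (cell l (pos z))) => e1; case: (eqVneq (cell l (pos x))) => e2.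
  + by move=> -> ->; rewrite e2 e1 eqxx.
  + by move=> -> []; rewrite -e1 (negPf e2).
  + by move=> [h1 h2] <-; rewrite e2 (negPf e1).
  + move=> [h1 h2] [h3 h4]; case: eqP; last by [].
    by move=> e; move: c1 c2 e1 e2; rewrite e; lia.
Qed.

Lemma transitionS m x y : transition m x y -> transition m.+1 x y.
Proof.
move=> [lxy pxy cxy exy]; split=> //; first by rewrite !cellS; lia.
by move=> l; move: (exy l); case: eqP => // _ []; lia.
Qed.

(* The second clause says that, on transitions staying in one level-[l] block,
   the operator is independent of the [l]-th exponent. *)
Definition bounded (m : nat) (T : op) : Prop :=
  supported (transition m) T /\
  forall l x g,
    (forall y, (pos x < pos y)%N -> cell l (pos x) != cell l (pos y) ->
       g y = 0) ->
    T (g \o shift l) x = T g (shift l x).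

Lemma boundedS m T : bounded m T -> bounded m.+1 T.
Proof.
by move=> [Ts Tc]; split=> // x g h; apply: Ts => y /transitionS /h.
Qed.

Lemma bounded_leq m n T : (m <= n)%N -> bounded m T -> bounded n T.
Proof.
move/subnK <-; elim: (n - m)%N => [|k IH] // /IH.
exact: boundedS.
Qed.

Lemma bounded0 : bounded 0 0.
Proof. by split. Qed.

Lemma boundedB m S T : bounded m S -> bounded m T -> bounded m (S - T).
Proof.
move=> [Ss Sc] [Ts Tc]; split=> [x g h|l x g h]; rewrite !fctE.
  by rewrite Ss ?Ts ?subrr.
by rewrite Sc ?Tc.
Qed.

Lemma bounded_comp m S T : subtractive S -> bounded m S -> bounded m T ->
  bounded m (S \o T).
Proof.
move=> Ssub [Ss Sc] [Ts Tc]; split=> [x g h|l x g h] /=.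
  by apply: Ss => z xz; apply: Ts => y zy; apply: h; apply: transition_trans zy.
rewrite -Sc => [|z pz cz]; last first.
  apply: Ts => y [_ pzy _ _]; apply: h; first exact: ltn_trans pzy.
  have := leq_cell l (ltnW pzy); have := leq_cell l (ltnW pz).
  by lia.
apply: (supported_eq Ssub Ss) => z [_ pz _ _] /=.
(* While [z] is in the block of [x], the second clause for [T] applies; once [z] has left it, [g]
   vanishes beyond [z] and both sides are zero. *)
have [cz|cz] := eqVneq (cell l (pos x)) (cell l (pos z)).
  by apply: Tc => y pzy; rewrite -cz; apply: h; apply: ltn_trans pzy.
have van w : (pos z < pos w)%N -> g w = 0.
  move=> pzw; apply: h; first exact: ltn_trans pzw.
  by have := leq_cell l (ltnW pzw); have := leq_cell l (ltnW pz); lia.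
by rewrite !Ts // => w [_ pzw _ _]; apply: van.
Qed.

(** * Commutators with the raising operator *)

Definition raise_op : op := fun g x => \sum_(l < lev x) g (shift l x).

Lemma raise_sub : subtractive raise_op.
Proof. by move=> g h; apply/funext => x; rewrite /raise_op !fctE -sumrB. Qed.

Definition ad (T : op) : op := (raise_op \o T) - (T \o raise_op).

Lemma adE T g x : ad T g x = raise_op (T g) x - T (raise_op g) x.
Proof. by rewrite /ad !fctE. Qed.

Lemma ad_sub T : subtractive T -> subtractive (ad T).
Proof.
move=> Tsub g h; apply/funext => x; rewrite !fctE !adE Tsub !raise_sub Tsub !fctE.
by lia.
Qed.

Lemma bounded_raise m T g x : subtractive T -> bounded m T ->
  T (raise_op g) x = \sum_(l < lev x) T (g \o shift l) x.
Proof.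
move=> Tsub [Ts _].
have -> : \sum_(l < lev x) T (g \o shift l) x
          = (T (\sum_(l < lev x) (g \o shift l))) x.
  by rewrite (subtractive_sum Tsub _ (fun l => g \o shift l)) fct_sumE.
apply: (supported_eq Tsub Ts) => y [ly _ _ _].
by rewrite fct_sumE /raise_op ly.
Qed.

(** The commutator is a sum over levels [k]. Its part staying in the block of level [k] cancels by
    independence of that exponent; on the part leaving it, [shift k] costs one unit at exit or at
    entry, whence [m.+1]. *)
Lemma bounded_ad m T : subtractive T -> bounded m T -> bounded m.+1 (ad T).
Proof.
move=> Tsub bT; have [Ts Tc] := bT; split=> [x g h|l x g h]; last first.
  rewrite !adE; congr (_ - _).
    by rewrite /raise_op /=; apply: eq_bigr => k _; rewrite Tc // shiftC.
  rewrite -Tc => [|y pxy cxy]; last by rewrite /raise_op big1 // => k _; rewrite h.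
  congr (T _ x); apply/funext => y; rewrite /raise_op /=.
  by apply: eq_bigr => k _; rewrite shiftC.
rewrite adE (bounded_raise _ _ Tsub bT) /raise_op -sumrB big1 // => k _.
(* Split [g] according to whether the block of level [k] containing [pos x] is left; only [gin] can
   contribute, and its two contributions agree. *)
pose gin : vect := fun y => if cell k (pos x) == cell k (pos y) then g y else 0.
pose gout : vect := fun y => if cell k (pos x) == cell k (pos y) then 0 else g y.
have gE : g = gin + gout.
  apply/funext => y; rewrite fctE /gin /gout.
  by case: ifP => _; rewrite ?addr0 ?add0r.
have -> : T g (shift k x) = T gin (shift k x).
  rewrite gE (subtractiveD Tsub) fctE [T gout _]Ts ?addr0 // => y.
  move=> [ly py cy ey]; rewrite /gout /=; case: ifPn => // ck; apply: h; split=> //.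
    by move: cy; rewrite !cellS /=; lia.
  move=> l; have := ey l; rewrite /=; case: (eqVneq (cell l (pos x))) => cl.
    have [E|] := eqVneq l k; last by rewrite addn0.
    by move: ck; rewrite -E cl eqxx.
  by case: (l == k); lia.
suff -> : T (g \o shift k) x = T (gin \o shift k) x.
  by rewrite Tc ?subrr // => y _ /negPf ck; rewrite /gin ck.
apply: (supported_eq Tsub Ts) => y [ly py cy ey] /=; rewrite /gin /=.
case: ifPn => // ck; apply: h; split=> //=.
  by move: cy; rewrite !cellS /=; lia.
move=> l; have := ey l; rewrite /=; case: (eqVneq (cell l (pos x))) => cl.
  have [E|] := eqVneq l k; last by rewrite addn0.
  by move: ck; rewrite -E cl eqxx.
by case: (l == k); lia.
Qed.

(** * The step operator *)

Definition next_state (x : state) : state :=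
  State (lev x) (pos x).+1
    (fun l => if cell l (pos x) == cell l (pos x).+1 then ex x l else 0%N).

Definition full (x : state) : Prop :=
  forall l, cell l (pos x) != cell l (pos x).+1 -> ex x l = quota l.

Definition step_op : op := fun g x => if `[< full x >] then g (next_state x) else 0.

Lemma step_sub : subtractive step_op.
Proof.
move=> g h; apply/funext => x; rewrite /step_op !fctE.
by case: ifP => // _; rewrite subrr.
Qed.

(** Exact quota at exit and reset to zero at entry give the bounds with no slack; [full] ignores the
    exponents of levels whose block is not left. *)
Lemma bounded_step : bounded 0 step_op.
Proof.
split=> [x g h|l x g h]; rewrite /step_op.
  case: asboolP => // fx; apply: h; split=> //=; last first.
    by move=> l; case: eqP => // /eqP/fx ->; rewrite addn0.
  rewrite /cell; have := divn_eq (pos x) (blen 0).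
  by rewrite /blen /=; lia.
have [cl|cl] := eqVneq (cell l (pos x)) (cell l (pos x).+1); last first.
  by rewrite /= !h //=; do 2!case: ifP.
have -> : next_state (shift l x) = shift l (next_state x).
  congr State; apply/funext => k /=; case: ifP => // /negbT ck.
  by have [E|] := eqVneq k l; rewrite ?addn0 //; move: ck; rewrite E cl eqxx.
suff -> : `[< full (shift l x) >] = `[< full x >] by [].
apply: asbool_equiv_eq; split=> f k ck; have := f k ck; rewrite /=;
  by have [E|] := eqVneq k l; rewrite ?addn0 //; move: ck; rewrite E /= cl eqxx.
Qed.

(** * The locally nilpotent ring *)

Definition tame : {pred op} :=
  fun T => `[< subtractive T /\ exists m, bounded m T >].

Lemma tameP T : reflect (subtractive T /\ exists m, bounded m T) (T \in tame).
Proof. exact: asboolP. Qed.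

Lemma tame_zmod_closed : zmod_closed tame.
Proof.
split=> [|S T /tameP[Ssub [m bS]] /tameP[Tsub [n bT]]].
  by apply/tameP; split; [move=> g h; rewrite subrr | exists 0%N; apply: bounded0].
apply/tameP; split.
  move=> g h; apply/funext => x; rewrite !fctE Ssub Tsub !fctE; lia.
exists (maxn m n); apply: boundedB; [move: bS | move: bT]; apply: bounded_leq.
  exact: leq_maxl.
exact: leq_maxr.
Qed.

HB.instance Definition _ := GRing.isZmodClosed.Build op tame tame_zmod_closed.

Record tame_op := TameOp { tval :> op; tvalP : tval \in tame }.
HB.instance Definition _ := [isSub for tval].
HB.instance Definition _ := [Choice of tame_op by <:].
HB.instance Definition _ := [SubChoice_isSubZmodule of tame_op by <:].

Lemma tval_inj (S T : tame_op) : (forall g, S g = T g) -> S = T.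
Proof. by move=> e; apply: val_inj; apply/funext. Qed.

Lemma tval0 g : (0 : tame_op) g = 0. Proof. by []. Qed.

Lemma tvalD (S T : tame_op) g : (S + T) g = S g + T g.
Proof. by []. Qed.

Lemma tvalN (T : tame_op) g : (- T) g = - T g.
Proof. by []. Qed.

Lemma tval_sub (T : tame_op) : subtractive T.
Proof. by case/tameP: (tvalP T). Qed.

Lemma tval_bounded (T : tame_op) : exists m, bounded m T.
Proof. by case/tameP: (tvalP T). Qed.

Lemma tame_comp (S T : tame_op) : (S \o T : op) \in tame.
Proof.
have [m bS] := tval_bounded S; have [n bT] := tval_bounded T.
apply/tameP; split; first by move=> g h; rewrite /= !tval_sub.
exists (maxn m n); apply: bounded_comp; first exact: tval_sub.
- by move: bS; apply: bounded_leq; apply: leq_maxl.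
- by move: bT; apply: bounded_leq; apply: leq_maxr.
Qed.

Definition tmul (S T : tame_op) : tame_op := TameOp (tame_comp S T).

Lemma tmulA : associative tmul.
Proof. by move=> S T U; apply: tval_inj. Qed.

Lemma tmulDl : left_distributive tmul +%R.
Proof. by move=> S T U; apply: tval_inj. Qed.

Lemma tmulDr : right_distributive tmul +%R.
Proof.
by move=> S T U; apply: tval_inj => g /=; rewrite (subtractiveD (tval_sub S)).
Qed.

Definition tame_ring : nuRing := NURing tmulA tmulDl tmulDr.

Lemma tame_ad (T : tame_op) : ad T \in tame.
Proof.
have [m bT] := tval_bounded T; apply/tameP; split.
  exact/ad_sub/tval_sub.
by exists m.+1; apply: bounded_ad => //; apply: tval_sub.
Qed.

Definition tame_der (T : tame_ring) : tame_ring := TameOp (tame_ad T).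

Lemma tame_derE (T : tame_ring) g : tame_der T g = raise_op (T g) - T (raise_op g).
Proof. by []. Qed.

Lemma tame_derP : derivation tame_der.
Proof.
split=> S T; apply: tval_inj => g.
  rewrite tame_derE !tvalD !tame_derE (subtractiveD raise_sub).
  by apply/funext => x; rewrite !fctE; lia.
change (raise_op (S (T g)) - S (T (raise_op g)) =
  raise_op (S (T g)) - S (raise_op (T g)) + S (raise_op (T g) - T (raise_op g))).
rewrite tval_sub.
by apply/funext => x; rewrite !fctE; lia.
Qed.

(** Finitely many generators share a bound [m], and the ring operations preserve it. *)
Lemma bounded_gen_subring (s : seq tame_ring) :
  exists m, forall T : tame_ring, gen_subring s T -> bounded m T.
Proof.
have [m bm] : exists m, forall T, T \in s -> bounded m (T : tame_op).
  elim: s => [|S s [m IH]]; first by exists 0%N.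
  have [n bS] := tval_bounded S; exists (maxn m n) => T.
  rewrite inE => /predU1P[->|/IH].
    by move: bS; apply: bounded_leq; apply: leq_maxr.
  by apply: bounded_leq; apply: leq_maxl.
exists m => T; elim=> {T} [T /bm //||S T _ bS _ bT|T _ bT|S T _ bS _ bT].
- by apply: bounded_leq bounded0.
- rewrite -[T]opprK; apply: boundedB => //.
  have : bounded m (0 - (T : op)) by apply: boundedB => //; apply: bounded_leq bounded0.
  by rewrite sub0r.
- have : bounded m (0 - (T : op)) by apply: boundedB => //; apply: bounded_leq bounded0.
  by rewrite sub0r.
- by apply: bounded_comp => //; apply: tval_sub.
Qed.

(** Every factor advances the position by at least one, while the composite is still a single
    transition for the same [m]. *)
Lemma bounded_foldl m (S : tame_ring) (Ts : seq tame_ring) :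
  bounded m S -> (forall T, T \in Ts -> bounded m (T : tame_op)) ->
  supported (fun x y => transition m x y /\ (pos x + size Ts < pos y)%N)
            (foldl (@nu_mul tame_ring) S Ts : tame_op).
Proof.
move=> bS; elim/last_ind: Ts => [|Ts T IH] bT.
  move=> x g h /=; apply: bS.1 => y xy; apply: h; split=> //.
  by rewrite addn0; case: xy.
have bT' U : U \in Ts -> bounded m (U : tame_op).
  by move=> hU; apply: bT; rewrite mem_rcons inE hU orbT.
rewrite foldl_rcons size_rcons => x g h /=; apply: (IH bT') => z [xz pz].
have [Tsupp _] : bounded m (T : tame_op) by apply: bT; rewrite mem_rcons mem_head.
apply: Tsupp => y zy; apply: h; split; first exact: transition_trans zy.
by case: zy => _ pzy _ _; lia.
Qed.

Lemma tame_ring_locally_nilpotent : locally_nilpotent tame_ring.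
Proof.
move=> s; have [m bm] := bounded_gen_subring s.
(* Moving more than [2 * blen m] positions changes the cell of level [m] by at least two, but a
   transition allows one. *)
exists (2 * blen m)%N => S Ts sz /bm bS bTs.
have supp := bounded_foldl bS (fun T hT => bm T (bTs T hT)).
apply: tval_inj => g; apply/funext => x; apply: supp => y [[_ _ cy _]].
by rewrite sz => /ltnW /(@cell_far m); lia.
Qed.

(** * Failure of quasi-regularity *)

Section DifferentialPolynomials.
Variable R : nuRing.

Lemma nu_mul0 (x : R) : nu_mul x 0 = 0.
Proof. by apply: (addIr (nu_mul x 0)); rewrite -nu_mulDr !add0r. Qed.

Lemma nu_0mul (x : R) : nu_mul 0 x = 0.
Proof. by apply: (addIr (nu_mul 0 x)); rewrite -nu_mulDl !add0r. Qed.

Lemma dcoef_trim (s : seq R) n : dcoef (trim s) n = dcoef s n.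
Proof.
elim: s n => //= x s IH [|n]; rewrite /dcoef.
  by case: ifP => //= /andP[_ /eqP].
by case: ifP => [/andP[/eqP e _]|_] /=; rewrite -/(dcoef s n) -IH /dcoef ?e ?nth_nil.
Qed.

Lemma dcoef_dadd (p q : seq R) n : dcoef (dadd p q) n = dcoef p n + dcoef q n.
Proof.
rewrite dcoef_trim /dcoef; have [lt_n|] := ltnP n (maxn (size p) (size q)).
  by rewrite nth_mkseq.
move=> le_n; rewrite nth_default ?size_mkseq //.
by move: le_n; rewrite geq_max => /andP[hp hq]; rewrite !nth_default ?addr0.
Qed.

Lemma dcoef_dopp (p : seq R) n : dcoef (dopp p) n = - dcoef p n.
Proof.
rewrite dcoef_trim /dcoef; have [lt_n|le_n] := ltnP n (size p).
  exact: nth_map.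
by rewrite !nth_default ?size_map ?oppr0.
Qed.

(** The list [[:: 0; a]] is [aX], and [(aX)(b X^n) = a b X^(n+1) + a D(b) X^n]. *)
Lemma dcoef_dmul_monomial (D : R -> R) (a : R) (q : seq R) n : D 0 = 0 ->
  dcoef (dmul D [:: 0; a] q) n =
  nu_mul a (D (dcoef q n)) + (if n is k.+1 then nu_mul a (dcoef q k) else 0).
Proof.
move=> D0; rewrite dcoef_trim {1}/dcoef.
have dq i : (size q <= i)%N -> dcoef q i = 0 by apply: nth_default.
have [lt_n|le_n] := ltnP n (size [:: 0; a] + size q); last first.
  rewrite nth_default ?size_mkseq // dq ?D0 ?nu_mul0 ?add0r; last by move: le_n => /=; lia.
  by case: n le_n => // n /= le_n; rewrite dq ?nu_mul0 //; lia.
rewrite nth_mkseq // !big_ord_recl big_ord0 /= addr0.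
rewrite big1 ?add0r => [|j _]; last first.
  by rewrite big1 // => k _; rewrite /dcoef /= nu_0mul mul0rn.
under eq_bigr => j _ do
  rewrite big_mkcond !big_ord_recl big_ord0 /= addr0 !mulr1n /bump /= !addn0.
rewrite big_split /= addrC; congr (_ + _).
  under eq_bigr => j _ do rewrite addnC eqn_add2r.
  rewrite -big_mkcond (big_ord1_eq _ (fun j => nu_mul a (D (dcoef q j)))).
  by case: ltnP => // le_n; rewrite dq // D0 nu_mul0.
case: n {lt_n} => [|n]; first by rewrite big1.
under eq_bigr => j _ do rewrite add1n eqSS.
rewrite -big_mkcond (big_ord1_eq _ (fun j => nu_mul a (dcoef q j))).
by case: ltnP => // le_n; rewrite dq // nu_mul0.
Qed.

End DifferentialPolynomials.

(** * Evaluation of polynomials at the raising operator *)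

Lemma step_tame : step_op \in tame.
Proof. by apply/tameP; split; [apply: step_sub | exists 0%N; apply: bounded_step]. Qed.

Definition step_elt : tame_ring := TameOp step_tame.

Lemma step_elt_neq0 : step_elt != 0.
Proof.
apply/eqP => e; have : step_elt (fun=> 1) (State 0 0 (fun=> 0%N)) = 0.
  by rewrite e.
(* The step from position 0 to 1 leaves no block, so [full] holds vacuously. *)
rewrite /= /step_op asboolT // => l /=.
by rewrite /cell !divn_small // /blen expnS; have := expn_gt0 4 l; lia.
Qed.

(** Substitutes [raise_op] for [X] in the first [n] terms of [q]. *)
Definition deval (q : seq tame_ring) (n : nat) : op :=
  fun g => \sum_(i < n) (dcoef q i : tame_op) (iter i raise_op g).

Lemma deval0 q g : deval q 0 g = 0.
Proof. exact: big_ord0. Qed.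

Lemma devalS q n g :
  deval q n.+1 g = deval q n g + (dcoef q n : tame_op) (iter n raise_op g).
Proof. exact: big_ord_recr. Qed.

(** Evaluates [q = aX q - aX] at [t = raise_op], giving [q(t) = a t (q(t) - 1)]. *)
Lemma deval_quasi_inverse (q : seq tame_ring) n g :
  dadd [:: 0; step_elt]
    (dadd q (dopp (dmul tame_der [:: 0; step_elt] q))) = [::] ->
  (size q <= n.+1)%N ->
  deval q n.+2 g = step_op (raise_op (deval q n.+2 g - g)).
Proof.
move=> qr szq.
have D0 : tame_der 0 = 0.
  by apply: (addIr (tame_der 0)); rewrite -(proj1 tame_derP) !add0r.
have qE i : (dcoef q i : tame_ring) = nu_mul step_elt (tame_der (dcoef q i)) +
    (if i is k.+1 then nu_mul step_elt (dcoef q k) else 0)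
    - dcoef [:: 0; step_elt] i.
  have nil0 : dcoef [::] i = 0 :> tame_ring by rewrite /dcoef nth_nil.
  have := congr1 (fun s => dcoef s i) qr.
  rewrite nil0 !dcoef_dadd dcoef_dopp dcoef_dmul_monomial // addrA => /eqP.
  by rewrite subr_eq0 => /eqP <-; rewrite addrAC subrr add0r.
have aD u v := subtractiveD step_sub u v.
have tD u v := subtractiveD raise_sub u v.
have coefE i h x : (dcoef q i : tame_op) h x =
    step_op (raise_op ((dcoef q i : tame_op) h)) x -
    step_op ((dcoef q i : tame_op) (raise_op h)) x +
    (if i is k.+1 then step_op ((dcoef q k : tame_op) h) x else 0) -
    (if i is 1%N then step_op h x else 0).
  rewrite {1}qE !tvalD tvalN !fctE; congr (_ + _ - _).
  - have e := step_sub (raise_op ((dcoef q i : tame_op) h)) ((dcoef q i : tame_op) (raise_op h)).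
    exact: (congr1 (fun u : vect => u x) e).
  - by case: i.
  - by case: i => [|[|i]] //; rewrite [dcoef _ _]nth_default.
(* Since [a D(q_i) = a t q_i - a q_i t], the terms [a q_i t^(i+1)] cancel against those from
   [a q_(i-1)], except the last; that one vanishes when [q] has no coefficient of index [k.+1]. *)
have telescope k : deval q k.+2 g = step_op (raise_op (deval q k.+2 g)) -
    step_op ((dcoef q k.+1 : tame_op) (raise_op (iter k.+1 raise_op g))) - step_op (raise_op g).
  elim: k => [|k IH].
    rewrite !devalS deval0 add0r tD aD [iter 0 _ _]/= [iter 1 _ _]/=.
    by apply/funext => x; have := coefE 0%N g x; have := coefE 1%N (raise_op g) x;
       rewrite !fctE; lia.
  rewrite devalS tD aD; apply/funext => x.
  have := congr1 (@^~ x) IH; have := coefE k.+2 (iter k.+2 raise_op g) x.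
  by rewrite !fctE [iter k.+2 _ _]iterS; lia.
rewrite {1}telescope raise_sub step_sub [dcoef q n.+1]nth_default // tval0.
by rewrite (subtractive0 step_sub) subr0.
Qed.

Lemma iter_raise_vanish (P : pred nat) n (g : vect) :
  (forall y, P (pos y) -> g y = 0) -> forall y, P (pos y) -> iter n raise_op g y = 0.
Proof.
move=> h; elim: n => [|n IH] y Py; first exact: h.
by rewrite /= /raise_op big1 // => l _; apply: IH.
Qed.

(** The finitely many coefficients share a bound [m], and powers of [raise_op] do not move the
    position. *)
Lemma deval_vanish (q : seq tame_ring) n : exists m, forall (g : vect) x,
  (forall y, (pos x < pos y)%N -> (cell m (pos y) <= (cell m (pos x)).+1)%N ->
     g y = 0) ->
  deval q n g x = 0.
Proof.
have [m bm] : exists m, forall i, (i < n)%N -> bounded m (dcoef q i : tame_op).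
  elim: n => [|n [m bm]]; first by exists 0%N.
  have [k bk] := tval_bounded (dcoef q n); exists (maxn m k) => i.
  rewrite ltnS leq_eqVlt => /predU1P[->|/bm].
    by move: bk; apply: bounded_leq; apply: leq_maxr.
  by apply: bounded_leq; apply: leq_maxl.
exists m => g x h; rewrite /deval fct_sumE big1 // => i _.
apply: (bm i (ltn_ord i)).1 => y [_ py cy _].
apply: (@iter_raise_vanish [pred j | (pos x < j)%N && (cell m j <= (cell m (pos x)).+1)%N]).
  by move=> z /andP[]; apply: h.
exact/andP.
Qed.

(** * The long walk *)

(** The exponent at level [l] counts the raises since the start of the current block of that level,
    the raise at [j] included. *)
Definition path_state (M j : nat) : state :=
  State M j (fun l => visits l (j %% blen l).+1).

Lemma visitsS l n : visits l n.+1 = (visits l n + (sched n == l))%N.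
Proof. exact: big_ord_recr. Qed.

Lemma visits0 l : visits l 0 = 0%N.
Proof. exact: big_ord0. Qed.

Lemma cell_next l j : (cell l j == cell l j.+1) = ~~ (blen l %| j.+1)%N.
Proof.
rewrite /cell divnS ?blen_gt0 //; case: (_ %| _)%N; last by rewrite eqxx.
by rewrite -[X in X == _]add0n eqn_add2r.
Qed.

Lemma path_full M j : full (path_state M j).
Proof.
move=> l /=; rewrite cell_next negbK => dv; congr visits.
have := ltn_pmod j (blen_gt0 l); rewrite leq_eqVlt => /predU1P[] // lt_r.
by move: dv; rewrite /dvdn -addn1 -modnDml addn1 modn_small.
Qed.

Lemma path_next M j :
  shift (sched j.+1) (next_state (path_state M j)) = path_state M j.+1.
Proof.
congr State; apply/funext => l /=; rewrite cell_next modnS [RHS]visitsS.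
rewrite [l == _]eq_sym.
rewrite -(@sched_eq_mod l (blen l) (if (blen l %| j.+1)%N then 0%N else (j %% blen l).+1)).
- by case: (_ %| _)%N; rewrite //= visits0.
- exact: dvdn_blen.
- by rewrite -modnS modn_mod.
Qed.

(* A vector satisfying this equation is minus the sum of the iterates of
   [step_op \o raise_op] on the indicator of position [J]. *)
Lemma path_value (h : vect) J j :
  h = step_op (raise_op (h - (fun x => (pos x == J)%:R))) ->
  (forall x, (J <= pos x)%N -> h x = 0) ->
  (j < J)%N -> h (path_state J.+1 j) <= -1.
Proof.
set g : vect := fun x => _ => hE h0.
(* Descending induction from [J]: all values are nonpositive, so other choices of raised levels
   cannot cancel the chosen walk. *)
have hle0 x : h x <= 0.
  have [n] := ubnP (J - pos x); elim: n x => // n IH x lt_n.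
  have [/h0 -> //|lt_J] := leqP J (pos x).
  rewrite hE /step_op; case: ifP => // _; apply: sumr_le0 => l _.
  rewrite fctE subr_le0; apply: le_trans (IH _ _) _ => /=; first by lia.
  by rewrite /g ler0n.
have [n] := ubnP (J - j); elim: n j => // n IH j lt_n lt_j.
(* [sched j.+1 < j.+2 <= J.+1]: taking [lev] equal to [J.+1] makes every scheduled level
   available. *)
have lt_s : (sched j.+1 < J.+1)%N by apply: leq_trans (ltn_logl _ _) _.
rewrite hE /step_op asboolT; last exact: path_full.
rewrite /raise_op (bigD1 (Ordinal lt_s)) //= path_next.
apply: (@le_trans _ _ ((h - g) (path_state J.+1 j.+1))).
  rewrite gerDl; apply: sumr_le0 => l _; rewrite fctE subr_le0.
  by apply: le_trans (hle0 _) _; rewrite /g ler0n.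
(* On reaching [J] the indicator contributes the [-1]; before that the bound is inherited from the
   next state. *)
rewrite !fctE /g /=; have [e|ne] := eqVneq j.+1 J.
  by rewrite h0 ?sub0r //= e.
by rewrite subr0; apply: IH; lia.
Qed.

Theorem mainTheorem10 :
  exists (R : nuRing) (D : R -> R),
    [/\ locally_nilpotent R, derivation D & ~ dpoly_jacobson_radical D].
Proof.
exists tame_ring, tame_der; split.
- exact: tame_ring_locally_nilpotent.
- exact: tame_derP.
move=> /(_ [:: 0; step_elt]) [|I [_ qrI /qrI [q [_ qr]]]].
  by rewrite /is_dpoly /= (negPf step_elt_neq0).
pose n := size q; have [m van] := deval_vanish q n.+2.
(* From position 0, [J] lies beyond the next block of level [m], so [deval] cannot see the indicator
   [g], whereas the walk forces a value at most [-1]. *)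
pose J := (2 * blen m)%N; pose g : vect := fun x => (pos x == J)%:R.
have Jgt0 : (0 < J)%N by rewrite muln_gt0 blen_gt0.
have : deval q n.+2 g (path_state J.+1 0) <= -1.
  apply: path_value Jgt0.
    exact: deval_quasi_inverse.
  move=> x Jx; apply: van => y lt_y _; rewrite /g gtn_eqF //.
  exact: leq_ltn_trans lt_y.
rewrite van // => y _ /= cy; rewrite /g; case: eqP => // e.
by have := @cell_far m 0 (pos y); rewrite e leqnn; move: cy; rewrite e; lia.
Qed.
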